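(* For every $n\ge 1$ there is a Horn (and hence URC) CNF formula $\varphi_n$ of size $O(n)$ such that (a) every PC formula equivalent to $\varphi_n$ has size $2^{\Omega(n)}$, and (b) there is a PC encoding of (the function represented by) $\varphi_n$ of size $O(n)$.
   Context: A CNF formula is a set of clauses; its size $|\varphi|$ is the number of clauses. A clause is Horn if it contains at most one positive literal; a Horn formula is a CNF of Horn clauses. A partial assignment $\alpha$ of variables $\mathbf{x}$ is a set of literals on $\mathbf{x}$ with no complementary pair, identified with the conjunction of its literals. Unit resolution derives $C\setminus\{l\}$ from a clause $C\ni l$ and the unit clause $\neg l$; $\varphi\vdash_1 C$ means $C$ is derivable by repeated unit resolution; $\bot$ is the empty clause. $\varphi(\mathbf{x})$ is URC if for every partial assignment $\alpha$ of $\mathbf{x}$, $\varphi\wedge\alpha\models\bot$ implies $\varphi\wedge\alpha\vdash_1\bot$; it is PC if for every partial assignment $\alpha$ and literal $l$ on $\mathbf{x}$ with $\varphi\wedge\alpha\models l$ we have $\varphi\wedge\alpha\vdash_1 l$ or $\varphi\wedge\alpha\vdash_1\bot$. A PC formula equivalent to $\varphi_n$ uses only the variables of $\varphi_n$. A CNF $\psi(\mathbf{x},\mathbf{y})$ is an encoding of a Boolean function $f(\mathbf{x})$ if for every $\mathbf{a}\in\{0,1\}^{\mathbf{x}}$, $f(\mathbf{a})=\exists\mathbf{b}\in\{0,1\}^{\mathbf{y}}\,\psi(\mathbf{a},\mathbf{b})$ ($\mathbf{y}$ are auxiliary variables); a PC encoding is an encoding that is a PC formula (over all its variables $\mathbf{x}\cup\mathbf{y}$).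 *)

(* Defs.v *)
From HB Require Import structures.
From mathcomp Require Import all_boot all_order all_algebra.
From mathcomp Require Import reals exp.
Set Implicit Arguments. Unset Strict Implicit. Unset Printing Implicit Defensive.
Import Order.TTheory GRing.Theory Num.Theory.

(* The variable set of a formula is the whole finite type [T].  The literal
   [(x, true)] is the variable [x], and [(x, false)] is its negation. *)
Notation literal T := (T * bool)%type (only parsing).
Notation clause T := {set literal T} (only parsing).
Notation cnf T := {set clause T} (only parsing).
Notation assignment T := {ffun T -> bool} (only parsing).

Section Cnf.
Variable T : finType.
Implicit Types (l : literal T) (C : clause T) (phi psi : cnf T).
Implicit Types (alpha : {set literal T}) (a : assignment T).

Definition neg_lit l : literal T := (l.1, ~~ l.2).

Definition cnf_size phi : nat := #|phi|.

Definition cnf_vars phi : {set T} :=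
  [set x | [exists C in phi, exists b : bool, (x, b) \in C]].

Definition horn_clause C : Prop := (#|[set l in C | l.2]| <= 1)%N.

Definition horn phi : Prop := forall C, C \in phi -> horn_clause C.

Definition lit_eval a l : bool := a l.1 == l.2.

Definition clause_eval a C : bool := [exists l in C, lit_eval a l].

Definition cnf_eval phi a : bool := [forall C in phi, clause_eval a C].

Definition entails phi C : Prop := forall a, cnf_eval phi a -> clause_eval a C.

Definition equivalent phi psi : Prop := forall a, cnf_eval phi a = cnf_eval psi a.

Definition bot : clause T := set0.

Definition unit_clause l : clause T := [set l].

Definition partial_assignment alpha : Prop :=
  forall l, l \in alpha -> neg_lit l \notin alpha.

Definition cnf_and phi alpha : cnf T := phi :|: [set unit_clause l | l in alpha].

Inductive unit_derives phi : clause T -> Prop :=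
| unit_derives_mem C : C \in phi -> unit_derives phi C
| unit_derives_res C l : unit_derives phi C -> l \in C ->
    unit_derives phi (unit_clause (neg_lit l)) -> unit_derives phi (C :\ l).

Definition URC phi : Prop :=
  forall alpha, partial_assignment alpha ->
    entails (cnf_and phi alpha) bot -> unit_derives (cnf_and phi alpha) bot.

Definition PC phi : Prop :=
  forall alpha l, partial_assignment alpha ->
    entails (cnf_and phi alpha) (unit_clause l) ->
    unit_derives (cnf_and phi alpha) (unit_clause l) \/
    unit_derives (cnf_and phi alpha) bot.

End Cnf.

Definition join_assignment (X Y : finType) (a : assignment X) (b : assignment Y) :
    assignment (X + Y)%type :=
  [ffun v => match v with inl x => a x | inr y => b y end].

(* [X] holds the main variables and [Y] the auxiliary ones. *)
Definition encoding (X Y : finType) (f : assignment X -> bool)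
    (psi : cnf (X + Y)%type) : Prop :=
  forall a : assignment X,
    f a = [exists b : assignment Y, cnf_eval psi (join_assignment a b)].

Definition PC_encoding (X Y : finType) (f : assignment X -> bool)
    (psi : cnf (X + Y)%type) : Prop :=
  encoding f psi /\ PC psi.

Definition linear_growth (R : realType) (s : nat -> nat) : Prop :=
  exists (K : R) (N : nat), (0 < K)%R /\
    forall n, (N <= n)%N -> ((s n)%:R <= K * n%:R)%R.

(* Main.v *)
(** The formula [phi_n] says that, once a guard [p] is true, a token placed on
    node [0] moves from node [i] to node [i + 1] as soon as one of two switches
    [(i, false)], [(i, true)] is on, and never reaches node [n].  Switching on
    one switch per level forces [~ p] but no other new literal, because all
    assignments with [p] false are models.  A PC formula therefore needs, for
    each of the [2 ^ n] choices, a clause made of [~ p] and the negated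
    switches of that choice, and none of these can be omitted.

    For the encoding, add for each node [k] four indicators of the possible
    values of the pair ([p], node [k]).  The constraint then decomposes into a
    chain of blocks of bounded size in which consecutive blocks communicate
    through these indicators only.  Taking all implicates inside each block is
    PC: supports found inside single blocks glue to a global model. *)
Require Import Defs.
From HB Require Import structures.
From mathcomp Require Import all_boot all_order all_algebra.
From mathcomp Require Import boolp reals exp.
Set Implicit Arguments. Unset Strict Implicit. Unset Printing Implicit Defensive.
Import Order.TTheory GRing.Theory Num.Theory.

(** * Unit resolution, and its completeness for refuting Horn formulas *)

Section UnitResolution.
Variable T : finType.
Implicit Types (phi : cnf T) (C B : clause T) (l : literal T).

Lemma neg_litK : involutive (@neg_lit T).
Proof. by case=> x b; rewrite /neg_lit /= negbK. Qed.

Lemma lit_eval_neg (a : assignment T) l : lit_eval a (neg_lit l) = ~~ lit_eval a l.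
Proof. by rewrite /lit_eval /=; case: (a _); case: l.2. Qed.

Lemma clause_eval_unit (a : assignment T) l :
  clause_eval a (unit_clause l) = lit_eval a l.
Proof.
apply/existsP/idP => [[m]|al]; first by rewrite inE => /andP[/eqP->].
by exists l; rewrite inE eqxx.
Qed.

Lemma cnf_eval_and phi (alpha : {set literal T}) (a : assignment T) :
  cnf_eval phi a -> (forall l, l \in alpha -> lit_eval a l) ->
  cnf_eval (cnf_and phi alpha) a.
Proof.
move=> /forall_inP aphi aalpha; apply/forall_inP => C /setUP[/aphi//|].
by case/imsetP => l lalpha ->; rewrite clause_eval_unit aalpha.
Qed.

Lemma unit_derives_sound phi C : unit_derives phi C -> entails phi C.
Proof.
move=> dC a aphi; elim: dC => [D Dphi|D l _ /existsP[m /andP[mD am]] lD _].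
  by move/forall_inP: aphi => /(_ _ Dphi).
rewrite clause_eval_unit lit_eval_neg => aNl; apply/existsP; exists m.
by rewrite !inE mD am !andbT; apply: contraNneq aNl => <-.
Qed.

(** Literals of [B] missing from [C] take no resolution step, so [B] need not lie inside [C]. *)
Lemma unit_derives_setD phi C B : unit_derives phi C ->
  (forall l, l \in B -> unit_derives phi (unit_clause (neg_lit l))) ->
  unit_derives phi (C :\: B).
Proof.
move=> dC; rewrite -[B]set_enum; elim: (enum B) => [|l s IHs] dB.
  suff -> : C :\: [set x in [::]] = C by [].
  by apply/setP => x; rewrite !inE.
have -> : C :\: [set x in l :: s] = (C :\: [set x in s]) :\ l.
  by apply/setP => x; rewrite !inE negb_or andbA.
have {}IHs : unit_derives phi (C :\: [set x in s]).
  by apply: IHs => x; rewrite inE => xs; apply: dB; rewrite !inE xs orbT.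
have [lCs|lCs] := boolP (l \in C :\: [set x in s]).
  by apply: unit_derives_res => //; apply: dB; rewrite !inE eqxx.
suff -> : (C :\: [set x in s]) :\ l = C :\: [set x in s] by [].
apply/setP => x; rewrite in_setD1 andbC.
by case: eqP => [->|_]; rewrite ?andbT // (negbTE lCs).
Qed.

(* If unit resolution does not refute a Horn formula, then making exactly the
   derived variables true satisfies it. *)
Lemma horn_URC phi : horn phi -> URC phi.
Proof.
move=> hphi alpha _ ubot; apply: contrapT => nbot.
pose a : assignment T :=
  [ffun x => `[< unit_derives (cnf_and phi alpha) (unit_clause (x, true)) >]].
suff /ubot : cnf_eval (cnf_and phi alpha) a.
  by case/existsP => l; rewrite inE.
have hC C : C \in cnf_and phi alpha -> horn_clause C.
  case/setUP => [/hphi//|/imsetP[l _ ->]].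
  rewrite /horn_clause (leq_trans (subset_leq_card _) (eq_leq (cards1 l))) //.
  by apply/subsetP => m; rewrite !inE => /andP[].
apply/forall_inP => C Cphi; apply: contrapT => /negP aC.
have {}aC l : l \in C -> ~~ lit_eval a l.
  by move=> lC; apply: contra aC => al; apply/existsP; exists l; rewrite lC.
(* The variables negated in a falsified clause are all derived. Resolving them away leaves the
   positive part, which is either a unit, and then makes the clause true after all, or the empty
   clause. *)
pose N := [set l in C | ~~ l.2].
have dN : unit_derives (cnf_and phi alpha) (C :\: N).
  apply: unit_derives_setD => [|[x b]]; first exact: unit_derives_mem.
  rewrite inE /= => /andP[/aC + /negbTE b0]; rewrite b0 /lit_eval /= ffunE.
  by case: asboolP.
have EN : C :\: N = [set l in C | l.2].
  apply/setP => l; rewrite !inE negb_and negbK; case: (l \in C) => //=.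
  by rewrite andbT.
rewrite EN in dN.
have := hC _ Cphi; rewrite /horn_clause leq_eqVlt ltnS leqn0 => /orP[|].
  case/cards1P => -[x b] Exb; have : (x, b) \in [set l in C | l.2].
    by rewrite Exb inE.
  rewrite inE /= => /andP[/aC + b1]; rewrite b1 in Exb *.
  rewrite /lit_eval /= ffunE; case: asboolP => // + _; apply.
  by rewrite Exb in dN.
by rewrite cards_eq0 => /eqP E0; apply: nbot; rewrite E0 in dN.
Qed.

End UnitResolution.

(** * The CNF of all single-block implicates of a set of models *)

Section Blocks.
Variables (T I : finType) (V : I -> {set T}) (G : pred (assignment T)).

Definition block_cnf : cnf T :=
  [set C : clause T | [exists i, C \subset [set l : literal T | l.1 \in V i]]
                      && [forall g, G g ==> clause_eval g C]].

Lemma block_cnf_sound g : G g -> cnf_eval block_cnf g.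
Proof.
move=> Gg; apply/forall_inP => C; rewrite inE => /andP[_ /forallP/(_ g)].
by rewrite Gg.
Qed.

Lemma mem_block_cnf i (C : clause T) :
  (forall l, l \in C -> l.1 \in V i) -> (forall g, G g -> clause_eval g C) ->
  C \in block_cnf.
Proof.
move=> CV GC; rewrite inE; apply/andP; split.
  by apply/existsP; exists i; apply/subsetP => l /CV; rewrite inE.
by apply/forallP => g; apply/implyP; apply: GC.
Qed.

(** Otherwise the clause forbidding the values of [h] on [V i] would be an implicate over that
    block, hence a member that [h] falsifies. *)
Lemma block_cnf_local h i :
  cnf_eval block_cnf h -> exists2 g, G g & {in V i, g =1 h}.
Proof.
move=> /forall_inP hG; apply: contrapT => nG.
pose C : clause T := [set l | (l.1 \in V i) && ~~ lit_eval h l].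
have /hG/existsP[l] : C \in block_cnf.
  apply: (@mem_block_cnf i) => [l|g Gg]; first by rewrite inE => /andP[].
  apply: contrapT => /negP gC; apply: nG; exists g => // v vV.
  apply: contraNeq gC => ghv; apply/existsP; exists (v, g v).
  by rewrite inE /= /lit_eval /= vV eqxx andbT eq_sym.
by rewrite inE; case: (lit_eval h l); rewrite ?andbF.
Qed.

(** At most [k] variables give at most [k * 2] literals, and a clause is a set of literals. *)
Lemma card_block_cnf k :
  (forall i, #|V i| <= k) -> #|block_cnf| <= #|I| * 2 ^ (k * 2).
Proof.
move=> Vk; pose L i : {set literal T} := setX (V i) setT.
apply: (@leq_trans #|\bigcup_i powerset (L i)|).
  apply/subset_leq_card/subsetP => C; rewrite inE => /andP[/existsP[i CV] _].
  apply/bigcupP; exists i => //; rewrite inE; apply: subset_trans CV _.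
  by apply/subsetP => -[v b]; rewrite !inE andbT.
rewrite -sum_nat_const; elim/big_rec2: _ => [|i m B _ IHB]; first by rewrite cards0.
apply: leq_trans (leq_card_setU _ _) (leq_add _ IHB).
rewrite card_powerset leq_exp2l // cardsX cardsT card_bool.
by rewrite leq_mul2r Vk.
Qed.

Section Support.
Variable alpha : {set literal T}.
Let derived (l : literal T) :=
  unit_derives (cnf_and block_cnf alpha) (unit_clause l).
Hypothesis nbot : ~ unit_derives (cnf_and block_cnf alpha) (bot T).

(** Without such a model, [neg_lit m] together with the negations of all derived literals on the
    block would be an implicate. Unit resolution would shrink it to [neg_lit m], or to the empty
    clause if [m] itself is derived. *)
Lemma block_support i m : m.1 \in V i -> ~ derived (neg_lit m) ->
  exists g, [/\ G g, lit_eval g m &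
                forall l, l.1 \in V i -> derived l -> lit_eval g l].
Proof.
move=> mV nm; apply: contrapT => nG.
pose B : clause T := [set l | (l.1 \in V i) && `[< derived (neg_lit l) >]].
have dB l : l \in B -> derived (neg_lit l).
  by rewrite inE => /andP[_ /asboolP].
have dC : unit_derives (cnf_and block_cnf alpha) (neg_lit m |: B).
  apply/unit_derives_mem/setUP; left; apply: (@mem_block_cnf i) => [l|g Gg].
    by rewrite !inE => /orP[/eqP->|/andP[]].
  apply: contrapT => /negP gC; apply: nG; exists g; split=> // [|l lV dl].
    apply: contraNT gC => gm; apply/existsP; exists (neg_lit m).
    by rewrite setU11 lit_eval_neg.
  apply: contraNT gC => gl; apply/existsP; exists (neg_lit l).
  rewrite lit_eval_neg gl andbT !inE [_.1]/= lV /=; apply/orP; right.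
  by apply/asboolP; rewrite neg_litK.
have := unit_derives_setD dC dB.
have [mB|mB] := boolP (neg_lit m \in B).
  suff -> : (neg_lit m |: B) :\: B = set0 by [].
  by apply/eqP; rewrite setD_eq0 subUset sub1set mB subxx.
suff -> : (neg_lit m |: B) :\: B = unit_clause (neg_lit m) by [].
apply/setP => l; rewrite !in_setD in_setU1 in_set1.
by case: eqP => [->|_]; rewrite ?mB //= andNb.
Qed.

End Support.
End Blocks.

(** * Propagation completeness of a chain of blocks *)

Section Chain.
Variables (T : finType) (n : nat) (V S : nat -> {set T}).
Variable G : pred (assignment T).
Hypothesis V_cover : forall v, exists2 i, i < n & v \in V i.
(** [S k] is the interface of blocks [k] and [k.+1]: one of its variables being true in two models
    is enough to splice them there. *)
Hypothesis S_sub : forall k, k.+1 < n -> S k \subset V k :&: V k.+1.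
Hypothesis S_true : forall k g, k.+1 < n -> G g -> exists2 v, v \in S k & g v.
Hypothesis G_glue : forall k g h v, k.+1 < n -> G g -> G h ->
  v \in S k -> g v -> h v ->
  exists f, [/\ G f, forall i, i <= k -> {in V i, f =1 g}
                   & forall i, k < i < n -> {in V i, f =1 h}].

(** If neither [l] nor the empty clause is derived, a support of [neg_lit l] in one block is
    extended block by block, first to the right, then to the left. The result is a model that
    respects every derived literal, hence [alpha], and refutes the entailment of [l]. *)
Lemma chain_block_cnf_PC : PC (block_cnf (fun i : 'I_n => V i) G).
Proof.
move=> alpha l _ ent; apply: contrapT => /not_orP[nl nbot].
pose derived m :=
  unit_derives (cnf_and (block_cnf (fun i : 'I_n => V i) G) alpha) (unit_clause m).
pose ok (g : assignment T) i := forall m, m.1 \in V i -> derived m -> lit_eval g m.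
have eq_ok (f g : assignment T) i : {in V i, f =1 g} -> ok g i -> ok f i.
  by move=> fg okg m mV dm; rewrite /lit_eval fg //; apply: okg.
(* A variable true in a model respecting the derived literals of block [j] does not have its
   negation derived, so it also has a support in block [i]. *)
have supp i v (g : assignment T) j : i < n -> v \in V i -> v \in V j ->
    g v -> ok g j -> exists h : assignment T, [/\ G h, h v & ok h i].
  move=> ltin vVi vVj gv okg.
  have [|h [Gh hv okh]] :=
    @block_support _ _ (fun i : 'I_n => V i) G _ nbot (Ordinal ltin) (v, true) vVi.
    by move=> /(okg (v, false) vVj); rewrite /lit_eval /= gv.
  by exists h; split=> //; move/eqP: hv.
have [i0 lti0n lV] := V_cover l.1.
have right k : i0 + k < n -> exists g, [/\ G g, lit_eval g (neg_lit l)
    & forall i, i0 <= i <= i0 + k -> ok g i].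
  elim: k => [|k IHk] ltkn.
    have [|g [Gg gl okg]] := @block_support _ _ (fun i : 'I_n => V i) G _ nbot
      (Ordinal lti0n) (neg_lit l) lV; first by rewrite neg_litK.
    exists g; split=> // i; rewrite addn0 -eqn_leq => /eqP <-; exact: okg.
  rewrite addnS in ltkn *.
  have [g [Gg gl okg]] := IHk (ltnW ltkn).
  have [v vS gv] := S_true ltkn Gg.
  have /setIP[vV vV'] := subsetP (S_sub ltkn) v vS.
  have okgk : ok g (i0 + k) by apply: okg; rewrite leq_addr leqnn.
  have [h [Gh hv okh]] := supp _ _ _ _ ltkn vV' vV gv okgk.
  have [f [Gf fg fh]] := G_glue ltkn Gg Gh vS gv hv.
  exists f; split=> // [|i /andP[lei0i]].
    by rewrite /lit_eval (fg i0) // leq_addr.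
  rewrite leq_eqVlt => /predU1P[->|ltik].
    by apply: eq_ok okh; apply: fh; rewrite ltkn andbT.
  by apply: (eq_ok _ g); [apply: fg | apply: okg; rewrite lei0i].
have left k : k <= i0 -> exists g, [/\ G g, lit_eval g (neg_lit l)
    & forall i, i0 - k <= i < n -> ok g i].
  elim: k => [|k IHk] leki0.
    (* The last block has index [n.-1], so this covers every block from [i0] on. *)
    have [|g [Gg gl okg]] := right (n.-1 - i0).
      by rewrite subnKC -ltnS prednK // (leq_ltn_trans _ lti0n).
    exists g; split=> // i; rewrite subn0 => /andP[lei0i ltin]; apply: okg.
    rewrite lei0i /= subnKC -ltnS prednK //; exact: leq_ltn_trans ltin.
  have [h [Gh hl okh]] := IHk (ltnW leki0).
  have Ek : i0 - k = (i0 - k.+1).+1 by rewrite subnSK.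
  have ltkn : (i0 - k.+1).+1 < n by rewrite -Ek (leq_ltn_trans (leq_subr _ _)).
  rewrite Ek in okh; set j := i0 - k.+1 in okh ltkn *.
  have [v vS hv] := S_true ltkn Gh.
  have /setIP[vV vV'] := subsetP (S_sub ltkn) v vS.
  have okhj : ok h j.+1 by apply: okh; rewrite leqnn.
  have [g [Gg gv okg]] := supp _ _ _ _ (ltnW ltkn) vV vV' hv okhj.
  (* Here the new support [g] takes the left side and the model [h] built so far the right. *)
  have [f [Gf fg fh]] := G_glue ltkn Gg Gh vS gv hv.
  exists f; split=> // [|i /andP[leji ltin]].
    by rewrite /lit_eval (fh i0) // lti0n andbT /j -Ek leq_subr.
  move: leji; rewrite leq_eqVlt => /predU1P[<-|ltji].
    by apply: eq_ok okg; apply: fg.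
  apply: (eq_ok _ h); first by apply: fh; rewrite ltji.
  by apply: okh; rewrite ltji.
have [g [Gg gl okg]] := left i0 (leqnn _).
have /ent : cnf_eval (cnf_and (block_cnf (fun i : 'I_n => V i) G) alpha) g.
  apply: cnf_eval_and => [|m malpha]; first exact: block_cnf_sound.
  have [i ltin mV] := V_cover m.1; apply: (okg i); rewrite ?subnn //.
  by apply: unit_derives_mem; rewrite inE imset_f ?orbT.
by rewrite clause_eval_unit; move: gl; rewrite lit_eval_neg => /negP.
Qed.

End Chain.

(** * The token formula as a Horn CNF *)

Section TokenFormula.
Variable n : nat.

(* [None] is the guard, [Some (inl k)] is node [k] and [Some (inr (i, b))] is
   switch [b] of level [i]. *)
Definition token_var : finType := option ('I_n.+1 + 'I_n * bool)%type.

Definition guard : token_var := None.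
Definition node (k : nat) : token_var := Some (inl (inord k)).
Definition switch (i : 'I_n) (b : bool) : token_var := Some (inr (i, b)).

Definition start_clause : clause token_var := [set (guard, false); (node 0, true)].
Definition move_clause (ib : 'I_n * bool) : clause token_var :=
  [set (guard, false); (node ib.1, false); (switch ib.1 ib.2, false);
       (node ib.1.+1, true)].
Definition end_clause : clause token_var := [set (guard, false); (node n, false)].

Definition token_cnf : cnf token_var :=
  start_clause |: (end_clause |: [set move_clause ib | ib : 'I_n * bool]).

Lemma token_cnf_evalP (a : assignment token_var) :
  reflect (a guard -> [/\ a (node 0), ~~ a (node n)
             & forall (i : 'I_n) b, a (node i) -> a (switch i b) -> a (node i.+1)])
          (cnf_eval token_cnf a).
Proof.
apply: (iffP forall_inP) => [aphi ag|aphi C].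
  split.
  - have /aphi/existsP[l] : start_clause \in token_cnf by rewrite setU11.
    rewrite !inE /lit_eval => /andP[/orP[]/eqP-> /=]; first by rewrite ag.
    by move/eqP.
  - have /aphi/existsP[l] : end_clause \in token_cnf by rewrite !inE eqxx orbT.
    rewrite !inE /lit_eval => /andP[/orP[]/eqP-> /=]; first by rewrite ag.
    by move/eqP->.
  move=> i b ai ab.
  have /aphi/existsP[l] : move_clause (i, b) \in token_cnf.
    by rewrite !inE imset_f ?orbT.
  rewrite !inE /lit_eval -!orbA => /andP[/or4P[]/eqP-> /=]; rewrite ?ag ?ai ?ab //.
  by move/eqP.
have lit_sat (D : clause token_var) v c : (v, c) \in D -> a v = c -> clause_eval a D.
  by move=> vD avc; apply/existsP; exists (v, c); rewrite vD /lit_eval avc /=.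
have [ag|ag] := boolP (a guard); last first.
  move=> Cphi; apply: (lit_sat _ guard false); last exact: negbTE.
  by move: Cphi => /setU1P[->|/setU1P[->|/imsetP[ib _ ->]]]; rewrite !inE eqxx.
have [a0 an astep] := aphi ag.
move=> /setU1P[->|/setU1P[->|/imsetP[[i b] _ ->]]].
- by apply: (lit_sat _ (node 0) true) => //; rewrite !inE eqxx orbT.
- by apply: (lit_sat _ (node n) false); rewrite ?(negbTE an) // !inE eqxx orbT.
have [ai|ai] := boolP (a (node i)); last first.
  by apply: (lit_sat _ (node i) false); rewrite ?(negbTE ai) // !inE eqxx !orbT.
have [ab|ab] := boolP (a (switch i b)); last first.
  by apply: (lit_sat _ (switch i b) false); rewrite ?(negbTE ab) // !inE eqxx !orbT.
by apply: (lit_sat _ (node i.+1) true); rewrite ?(astep i b) // !inE eqxx !orbT.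
Qed.

Lemma token_cnf_horn : horn token_cnf.
Proof.
move=> C CP; suff [l Cl] : exists l, [set m in C | m.2] \subset [set l].
  by rewrite /horn_clause -(cards1 l) subset_leq_card.
move: CP => /setU1P[->|/setU1P[->|/imsetP[ib _ ->]]].
- exists (node 0, true); apply/subsetP => m; rewrite !inE.
  by case/andP => /orP[]/eqP->.
(* The end clause has no positive literal, so any witness serves. *)
- exists (node 0, true); apply/subsetP => m; rewrite !inE.
  by case/andP => /orP[]/eqP->.
- exists (node ib.1.+1, true); apply/subsetP => m; rewrite !inE -!orbA.
  by case/andP => /or4P[]/eqP->.
Qed.

(** Ensures that a CNF over the type [token_var] uses only variables of the formula. *)
Lemma token_cnf_vars x : x \in cnf_vars token_cnf.
Proof.
have vars (C : clause token_var) v b :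
    C \in token_cnf -> (v, b) \in C -> v \in cnf_vars token_cnf.
  move=> CP vC; rewrite inE; apply/existsP; exists C; rewrite CP /=.
  by apply/existsP; exists b.
have start_in : start_clause \in token_cnf by rewrite setU11.
have move_in ib : move_clause ib \in token_cnf by rewrite !inE imset_f ?orbT.
case: x => [[[[|k] ltk]|[i b]]|].
- apply: (vars _ _ true start_in).
  by rewrite /node (_ : Ordinal _ = inord 0) ?set22 //; apply: val_inj; rewrite /= inordK.
- apply: (vars _ _ true (move_in (Ordinal (ltk : k < n), true))).
  rewrite /move_clause /node (_ : Ordinal ltk = inord k.+1) ?inE ?eqxx ?orbT //.
  by apply: val_inj; rewrite /= inordK.
- by apply: (vars _ _ false (move_in (i, b))); rewrite !inE eqxx !orbT.
- by apply: (vars _ _ false start_in); rewrite !inE eqxx.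
Qed.

Lemma card_token_cnf : #|token_cnf| <= n * 2 + 2.
Proof.
rewrite !cardsU1 addnA addnC leq_add //; last by do 2!case: (_ \notin _).
by rewrite (leq_trans (leq_imset_card _ _)) // card_prod card_ord card_bool.
Qed.

(** * The exponential lower bound for equivalent PC formulas *)

Section LowerBound.
Variable psi : cnf token_var.
Hypotheses (psi_PC : PC psi) (psi_eq : equivalent psi token_cnf).

Definition choice_lits (s : {ffun 'I_n -> bool}) : {set literal token_var} :=
  [set (switch i (s i), true) | i : 'I_n].

Definition choice_clause (s : {ffun 'I_n -> bool}) : clause token_var :=
  (guard, false) |: [set (switch i (s i), false) | i : 'I_n].

(** With the guard true, the chosen switches would carry the token from node 0 to node [n]. *)
Lemma choice_lits_entail s :
  entails (cnf_and psi (choice_lits s)) (unit_clause (guard, false)).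
Proof.
move=> a /forall_inP aE; rewrite clause_eval_unit /lit_eval /= eqbF_neg.
apply/negP => ag.
have : cnf_eval token_cnf a.
  by rewrite -psi_eq; apply/forall_inP => C Cpsi; apply: aE; rewrite inE Cpsi.
case/token_cnf_evalP/(_ ag) => a0 /negP an astep.
suff an' k : k <= n -> a (node k) by apply/an/an'.
elim: k => [//|k IHk] ltkn.
apply: (astep (Ordinal ltkn) (s (Ordinal ltkn))); first exact/IHk/ltnW.
have /aE : unit_clause (switch (Ordinal ltkn) (s (Ordinal ltkn)), true)
    \in cnf_and psi (choice_lits s).
  by rewrite inE imset_f ?orbT // imset_f.
by rewrite clause_eval_unit => /eqP.
Qed.

(* Without a clause inside [choice_clause s], every clause derived by unit
   resolution other than the assumptions keeps a literal outside
   [choice_clause s]; in particular [~ guard] is not derived. *)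
Lemma choice_subclause s : exists2 C, C \in psi & C \subset choice_clause s.
Proof.
apply: contrapT => nC.
(* With the guard false every assignment is a model, so any other variable [v0] can be set freely
   while the remaining variables follow the choice. *)
pose a0 (v0 : token_var) c : assignment token_var :=
  [ffun v => if v == guard then false else if v == v0 then c
             else (v, true) \in choice_lits s].
have a0_sat v0 c : cnf_eval psi (a0 v0 c).
  by rewrite psi_eq; apply/token_cnf_evalP; rewrite ffunE eqxx.
have partial : partial_assignment (choice_lits s).
  by move=> _ /imsetP[i _ ->]; apply/imsetP => -[].
have inv D : unit_derives (cnf_and psi (choice_lits s)) D ->
    D \in [set unit_clause l | l in choice_lits s] \/ ~~ (D \subset choice_clause s).
  elim=> [E /setUP[Epsi|]|E l dE IHE lE dl IHl]; [right|by left|].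
    by apply/negP => Es; apply: nC; exists E.
  (* A unit neither assumed nor inside [choice_clause s] is falsified by some [a0], so soundness
     excludes it: the resolving unit is an assumption. *)
  have lalpha : neg_lit l \in choice_lits s.
    case: IHl => [/imsetP[m ma /set1_inj -> //]|].
    rewrite sub1set => nls; apply: contrapT => /negP nla.
    have := unit_derives_sound dl; rewrite /entails.
    case: (neg_lit l) nls nla => v c nls nla /(_ (a0 v (~~ c))) ent.
    have : lit_eval (a0 v (~~ c)) (v, c).
      rewrite -clause_eval_unit; apply/ent/cnf_eval_and => // _ /imsetP[i _ ->].
      rewrite /lit_eval ffunE /=; case: (_ =P v) => [Ev|_].
        by case: c nla {nls ent} => //; rewrite -Ev imset_f.
      by rewrite imset_f.
    rewrite /lit_eval ffunE /= eqxx; case: (v =P guard) => [Ev|_]; last by case: c {nls nla ent}.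
    by move=> /eqP Ec; rewrite Ev -Ec setU11 in nls.
  (* The removed literal is the negation of an assumption, so it lies inside [choice_clause s] and
     the literal outside survives. *)
  right; case: IHE => [/imsetP[m ma Em]|/subsetPn[m mE ms]].
    move: lE; rewrite Em inE => /eqP Elm; have := partial _ ma.
    by rewrite -Elm lalpha.
  apply/subsetPn; exists m => //; rewrite !inE mE andbT.
  apply: contraNneq ms => ->; rewrite !inE; apply/orP; right.
  case/imsetP: lalpha => i _ El; rewrite -[l]neg_litK El.
  by apply/imsetP; exists i.
have [] := psi_PC partial (@choice_lits_entail s).
- move=> /inv[/imsetP[m /imsetP[i _ ->] /set1_inj//]|/negP[]].
  by rewrite sub1set setU11.
- move=> /inv[/imsetP[m _ /setP/(_ m)]|/negP[]]; last exact: sub0set.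
  by rewrite !inE eqxx.
Qed.

(** Turning both switches of level [i] off stops the token at node [i]. This model with the guard on
    falsifies every other literal of [choice_clause s]. *)
Lemma choice_subclause_full s C i : C \in psi -> C \subset choice_clause s ->
  (switch i (s i), false) \in C.
Proof.
move=> Cpsi Cs; apply: contrapT => iC.
pose a : assignment token_var := [ffun v : token_var =>
  match v with None => true | Some (inl k) => k <= i
             | Some (inr (j, b)) => (j != i) && (b == s j) end].
have aE k : k <= n -> a (node k) = (k <= i).
  by move=> lekn; rewrite /node ffunE inordK.
have /forall_inP/(_ C Cpsi)/existsP[l /andP[lC]] : cnf_eval psi a.
  rewrite psi_eq; apply/token_cnf_evalP => _; split.
  - by rewrite aE.
  - by rewrite aE // -ltnNge.
  move=> j b; rewrite !aE ?[a (switch _ _)]ffunE // ?(ltnW (ltn_ord j)) //.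
  by move=> leji /andP[nji _]; rewrite ltn_neqAle leji nji.
move/subsetP/(_ _ lC): Cs; rewrite !inE => /orP[/eqP->|/imsetP[j _ El]].
  by rewrite /lit_eval ffunE.
rewrite El /lit_eval ffunE /= eqxx andbT eqbF_neg negbK => /eqP ij.
by apply: iC; rewrite -ij -El.
Qed.

Lemma PC_token_cnf_lower_bound : 2 ^ n <= #|psi|.
Proof.
have /choice[F FP] : forall s, exists C, C \in psi /\ C \subset choice_clause s.
  by move=> s; have [C] := choice_subclause s; exists C.
(* The clause for [s] contains all negated switches of [s]; lying inside [choice_clause t] as well
   forces [s = t]. *)
have F_inj : injective F.
  move=> s t Fst; apply/ffunP => i; have [Fs sF] := FP s; have [_ tF] := FP t.
  have := subsetP tF _; rewrite -Fst => /(_ _ (choice_subclause_full i Fs sF)).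
  by rewrite !inE => /imsetP[j _ [-> ->]].
rewrite -[2]card_bool -[X in _ ^ X]card_ord -card_ffun -cardsT -(card_imset _ F_inj).
by apply/subset_leq_card/subsetP => _ /imsetP[s _ ->]; case: (FP s).
Qed.

End LowerBound.

(** * The PC encoding of linear size *)

(* [(k, (c, d))] indicates that the guard is [c] and node [k] is [d]. *)
Definition state_var : finType := ('I_n.+1 * (bool * bool))%type.

Local Notation enc_var := (token_var + state_var)%type.

Definition indicator (k : nat) (cd : bool * bool) : enc_var := inr (inord k, cd).

Definition state_at (g : assignment enc_var) (k : nat) : bool * bool :=
  (g (inl guard), g (inl (node k))).

Definition state_assignment (a : assignment token_var) : assignment state_var :=
  [ffun kcd : state_var => (a guard, a (node kcd.1)) == kcd.2].

Definition main_part (g : assignment enc_var) : assignment token_var :=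
  [ffun x => g (inl x)].

Definition token_model (g : assignment enc_var) : bool :=
  cnf_eval token_cnf (main_part g)
  && [forall kcd : state_var, g (inr kcd) == (state_at g kcd.1 == kcd.2)].

Lemma token_modelP (g : assignment enc_var) : reflect
  [/\ g (inl guard) -> [/\ g (inl (node 0)), ~~ g (inl (node n))
        & forall (i : 'I_n) b, g (inl (node i)) -> g (inl (switch i b)) ->
            g (inl (node i.+1))]
    & forall k cd, k <= n -> g (indicator k cd) = (state_at g k == cd)]
  (token_model g).
Proof.
have evalP : reflect (g (inl guard) -> [/\ g (inl (node 0)), ~~ g (inl (node n))
    & forall (i : 'I_n) b, g (inl (node i)) -> g (inl (switch i b)) ->
      g (inl (node i.+1))]) (cnf_eval token_cnf (main_part g)).
  apply: (iffP (token_cnf_evalP _)); rewrite !ffunE => H /H[H0 Hn Hs]; split=> // i b.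
    by have := Hs i b; rewrite !ffunE.
  by rewrite !ffunE; apply: Hs.
apply: (iffP andP) => [[/evalP Hg /forallP Hs]|[Hg Hs]]; split=> //.
- by move=> k cd lekn; rewrite /indicator (eqP (Hs _)) /= inordK.
- exact/evalP.
apply/forallP => -[k cd] /=; rewrite -Hs ?leq_ord //.
by rewrite /indicator inord_val.
Qed.

(** Block [i] holds what the moves of level [i] mention. The guard lies in every block, which is why
    the indicators record its value along with that of the node. *)
Definition block (i : nat) : {set enc_var} := [set v : enc_var |
  match v with
  | inl None => true
  | inl (Some (inl k)) => (k == i :> nat) || (k == i.+1 :> nat)
  | inl (Some (inr (j, _))) => j == i :> nat
  | inr (k, _) => (k == i :> nat) || (k == i.+1 :> nat)
  end].

(** Positions within one block: the guard, two nodes, two switches and eight indicators. Their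
    number does not depend on [n]. *)
Definition block_shape : finType := option (bool + bool + bool * (bool * bool))%type.

Lemma card_block i : i < n -> #|block i| <= #|block_shape|.
Proof.
move=> ltin; pose F (s : block_shape) : enc_var := match s with
  | None => inl guard
  | Some (inl (inl e)) => inl (node (e + i))
  | Some (inl (inr b)) => inl (switch (Ordinal ltin) b)
  | Some (inr (e, cd)) => indicator (e + i) cd
  end.
rewrite -cardsT (leq_trans _ (leq_imset_card F _)) // subset_leq_card //.
have inordE (k : 'I_n.+1) : (k == i :> nat) || (k == i.+1 :> nat) ->
    exists e : bool, inord (e + i) = k.
  by case/orP => /eqP Ek; [exists false | exists true];
     apply: val_inj; rewrite /= inordK /= ?add0n ?add1n -?Ek.
apply/subsetP => -[[[k|[j b]]|]|[k cd]]; rewrite inE.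
- by case/inordE => e Ek; apply/imsetP; exists (Some (inl (inl e))); rewrite // /F /node Ek.
- move=> /eqP Ej; apply/imsetP; exists (Some (inl (inr b))) => //.
  by congr (inl (Some (inr (_, _)))); apply: val_inj.
- by move=> _; apply/imsetP; exists None.
- by case/inordE => e Ek; apply/imsetP; exists (Some (inr (e, cd))); rewrite // /F /indicator Ek.
Qed.

Definition token_encoding : cnf enc_var := block_cnf (fun i : 'I_n => block i) token_model.

Lemma card_token_encoding : #|token_encoding| <= n * 2 ^ (#|block_shape| * 2).
Proof.
by rewrite -[X in X * _]card_ord; apply: card_block_cnf => i; apply: card_block.
Qed.

Hypothesis n_gt0 : 0 < n.

Lemma block_node i k : k <= n -> (k == i) || (k == i.+1) -> inl (node k) \in block i.
Proof. by move=> lekn ki; rewrite inE /node inordK. Qed.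

Lemma token_encoding_correct : encoding (cnf_eval token_cnf) token_encoding.
Proof.
move=> a; apply/idP/existsP => [phia|[b psiab]].
  exists (state_assignment a); apply: block_cnf_sound.
  apply/andP; split.
    by rewrite (_ : main_part _ = a) //; apply/ffunP => x; rewrite !ffunE.
  by apply/forallP => kcd; rewrite /state_at !ffunE.
have local i : i < n -> exists2 g, token_model g &
    forall x, inl x \in block i -> g (inl x) = a x.
  move=> ltin; have [g Gg gab] := block_cnf_local (Ordinal ltin) psiab.
  by exists g => // x xi; rewrite gab // ffunE.
have guard_in i : inl guard \in block i by rewrite inE.
apply/token_cnf_evalP => ag; split.
(* The start is checked in block 0, the end in block [n.-1] and each move in its own block, where
   [a] agrees with a token model. *)
- have [g /token_modelP[+ _] ga] := local 0 n_gt0; rewrite ga // => /(_ ag)[+ _ _].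
  by rewrite ga // block_node.
- have ltn1 : n.-1 < n by rewrite prednK.
  have [g /token_modelP[+ _] ga] := local _ ltn1; rewrite ga // => /(_ ag)[_ + _].
  by rewrite ga // block_node // prednK // eqxx orbT.
move=> i c; have [g /token_modelP[+ _] ga] := local i (ltn_ord i).
rewrite ga // => /(_ ag)[_ _ /(_ i c)]; rewrite !ga //.
- by rewrite block_node // eqxx orbT.
- by rewrite inE /=.
- by rewrite block_node ?eqxx // ltnW.
Qed.

(** Blocks [k] and [k.+1] meet at node [k.+1], hence the shift. *)
Definition separator (k : nat) : {set enc_var} := [set indicator k.+1 cd | cd : bool * bool].

(** The cut is at node [k]: the switches of level [k] belong to the block on its right, so for them
    the comparison is strict. *)
Definition splice (k : nat) (g h : assignment enc_var) : assignment enc_var :=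
  [ffun v : enc_var => match v with
   | inl None => g v
   | inl (Some (inl j)) => if j <= k then g v else h v
   | inl (Some (inr (j, _))) => if j < k then g v else h v
   | inr (j, _) => if j <= k then g v else h v
   end].

Lemma splice_glue k (g h : assignment enc_var) : k <= n -> token_model g -> token_model h ->
    state_at g k = state_at h k ->
  [/\ token_model (splice k g h), forall i, i < k -> {in block i, splice k g h =1 g}
    & forall i, k <= i < n -> {in block i, splice k g h =1 h}].
Proof.
move=> lekn /token_modelP[gP gs] /token_modelP[hP hs] Egh.
have [Eg Ek] : g (inl guard) = h (inl guard) /\ g (inl (node k)) = h (inl (node k)).
  by case: Egh.
have sg : splice k g h (inl guard) = g (inl guard) by rewrite ffunE.
have sn j : j <= n -> splice k g h (inl (node j)) =
    if j <= k then g (inl (node j)) else h (inl (node j)).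
  by move=> lejn; rewrite ffunE /= inordK.
have si j cd : j <= n -> splice k g h (indicator j cd) =
    if j <= k then g (indicator j cd) else h (indicator j cd).
  by move=> lejn; rewrite ffunE /= inordK.
have Ei cd : g (indicator k cd) = h (indicator k cd) by rewrite gs ?hs ?Egh.
split.
- apply/token_modelP; split=> [|j cd lejn]; last first.
    rewrite si // gs // hs // /state_at sg sn //.
    by case: leqP => // _; rewrite Eg.
  rewrite sg => gg; have [g0 gn gstep] := gP gg.
  rewrite Eg in gg; have [h0 hn hstep] := hP gg.
  split; rewrite ?sn //.
    by case: leqP.
  move=> i b; rewrite !sn ?(ltnW (ltn_ord i)) // [splice _ _ _ _]ffunE /=.
  (* At level [k] the switch and the next node come from [h], and node [k] from [g], where both
     models agree. *)
  case: (ltngtP i k) => [ltik|ltki|Eik]; [exact: gstep|exact: hstep|].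
  by rewrite Eik Ek -Eik; apply: hstep.
- move=> i ltik [[[j|[j b]]|]|[j cd]]; rewrite inE ffunE //.
  + by case/orP => /eqP->; rewrite ?ltik // ltnW.
  + by move=> /eqP->; rewrite ltik.
  + by case/orP => /eqP->; rewrite ?ltik // ltnW.
- move=> i /andP[leki ltin] [[[j|[j b]]|]|[j cd]]; rewrite inE ffunE //.
  + case: leqP => // lejk Ej.
    have -> : j = inord k.
      apply: val_inj; rewrite /= inordK //; apply/eqP; rewrite eqn_leq lejk.
      by case/orP: Ej => /eqP->; rewrite ?leki // ltnW.
    exact: Ek.
  + by move=> /eqP Ej; rewrite Ej ltnNge leki.
  + case: leqP => // lejk Ej.
    have -> : j = inord k.
      apply: val_inj; rewrite /= inordK //; apply/eqP; rewrite eqn_leq lejk.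
      by case/orP: Ej => /eqP->; rewrite ?leki // ltnW.
    exact: Ei.
Qed.

Lemma token_encoding_PC : PC token_encoding.
Proof.
apply: (@chain_block_cnf_PC _ n block separator).
- have cover (k : 'I_n.+1) : exists2 i, i < n & (k == i :> nat) || (k == i.+1 :> nat).
    case: k => [[|k] ltkn]; first by exists 0.
    by exists k; rewrite //= eqxx orbT.
  move=> [[[k|[j b]]|]|[k cd]].
  + by have [i ltin ki] := cover k; exists i => //; rewrite inE.
  + by exists j => //; rewrite inE.
  + by exists 0 => //; rewrite inE.
  + by have [i ltin ki] := cover k; exists i => //; rewrite inE.
- move=> k ltkn; apply/subsetP => _ /imsetP[cd _ ->].
  by rewrite !inE /indicator /= inordK ?eqxx ?orbT // ltnS ltnW.
- move=> k g ltkn /token_modelP[_ gs]; exists (indicator k.+1 (state_at g k.+1)).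
    by rewrite imset_f.
  by rewrite gs // ltnW.
- move=> k g h v ltkn Gg Gh /imsetP[cd _ ->].
  have lekn := ltnW ltkn.
  (* A common true indicator means that both models have the same state at node [k.+1]. *)
  have /token_modelP[_ ->//] := Gg; have /token_modelP[_ ->//] := Gh.
  move=> /eqP Eg /eqP Eh.
  have [|Gf fg fh] := splice_glue lekn Gg Gh; first by rewrite Eg Eh.
  by exists (splice k.+1 g h).
Qed.

End TokenFormula.

Theorem theorem2 (R : realType) :
  exists (X : nat -> finType) (phi : forall n : nat, cnf (X n)),
    [/\ forall n : nat, (1 <= n)%N ->
          [/\ forall x : X n, x \in cnf_vars (phi n), horn (phi n) & URC (phi n)],
        linear_growth R (fun n => cnf_size (phi n)),
        exists (c : R) (N : nat), (0 < c)%R /\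
          forall n : nat, (N <= n)%N -> forall psi : cnf (X n),
            PC psi -> equivalent psi (phi n) ->
            (2 `^ (c * n%:R) <= (cnf_size psi)%:R)%R
      & exists (Y : nat -> finType) (psi : forall n : nat, cnf (X n + Y n)%type),
          (forall n : nat, (1 <= n)%N -> PC_encoding (cnf_eval (phi n)) (psi n)) /\
          linear_growth R (fun n => cnf_size (psi n))].
Proof.
exists token_var, token_cnf; split.
- move=> n _; split; [exact: token_cnf_vars|exact: token_cnf_horn|].
  exact/horn_URC/token_cnf_horn.
(* The bound [n * 2 + 2] is at most [4 * n] once [n] is positive. *)
- exists 4%:R%R, 1; split=> [|n n_gt0]; first by rewrite ltr0n.
  rewrite -natrM ler_nat (leq_trans (card_token_cnf n)) //.
  by rewrite mulnC -[4]/(2 + 2) mulnDl leq_add2l -{1}[2]muln1 leq_mul2l.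
- exists 1%R, 0; split=> [|n _ psi psi_PC psi_eq]; first exact: ltr01.
  rewrite mul1r powR_mulrn ?ler0n // -natrX ler_nat.
  exact: PC_token_cnf_lower_bound.
exists state_var, token_encoding; split=> [n n_gt0|].
  by split; [exact: token_encoding_correct|exact: token_encoding_PC].
(* The constant bounds the number of clauses over one block, and there are [n] blocks. *)
exists (2 ^ (#|block_shape| * 2))%:R%R, 1; split=> [|n _].
  by rewrite ltr0n expn_gt0.
by rewrite -natrM ler_nat mulnC; apply: card_token_encoding.
Qed.
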